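(* Let $U\subset\mathcal Y$ be open and let $w:U\to\mathbb R$ be continuous and locally bounded. Assume: (H1) $\mathcal Y$ is reflexive; (H2) there exists $M:\mathcal Y\times\mathcal Y\to[0,\infty]$ such that $y_1\mapsto M(y_1,y_2)$ is Fréchet differentiable at every $y_1\neq y_2$ and $y_2\mapsto M(y_1,y_2)$ is Fréchet differentiable at every $y_2\ne y_1$, and there are constants $\lambda\in(0,1]$, $\Lambda\in[1,\infty)$ with $\lambda\|y_1-y_2\|\le M(y_1,y_2)\le\Lambda\|y_1-y_2\|$ for all $y_1,y_2\in\mathcal Y$, and $\lambda\le\|\nabla M(\cdot,y_2)(y_1)\|_{\mathcal Y^*}$ and $\|\nabla M(y_1,\cdot)(y_2)\|_{\mathcal Y^*}\le\Lambda$ whenever these derivatives are defined; (i) for every $x\in X$, every $u\in U$ and every unit $d\in\mathcal Y$ the directional derivative $D_df_x(u)$ exists, and there is a constant $C_0>0$ such that $\inf_{x\in S(u)}D_df_x(u)>-C_0$ for all $u\in U$ and all unit $d$; (ii) for every unit $d\in\mathcal Y$, $w$ is a viscosity subsolution in $U$ of $-\langle\nabla w(u),d\rangle+\inf_{x\in S(u)}D_df_x(u)=0$. Then $w$ is locally Lipschitz in $U$.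
   Context: Let $\mathfrak X,\mathcal Y$ be real Banach spaces, $X\subset\mathfrak X$ and $U\subset\mathcal Y$ nonempty, $f:X\times U\to\mathbb R$ continuous, and $\Phi:U\to2^X$ a set-valued map. The optimal value function is $v(u)=\inf_{x\in\Phi(u)}f(x,u)$ and the optimal set map is $S(u)=\{x\in\Phi(u):f(x,u)=v(u)\}$. For $x\in X$, $f_x(u):=f(x,u)$, and $D_df_x(u)=\lim_{s\downarrow0}\frac{f(x,u+sd)-f(x,u)}{s}$ is the directional derivative. A unit vector is one of norm $1$; the infimum over the empty set is $+\infty$. For $w:U\to\mathbb R$ ($U$ open) and $u_0\in U$: $\mathcal J^+w(u_0)=\{p\in\mathcal Y^*:\limsup_{u\to u_0}\frac{w(u)-w(u_0)-\langle p,u-u_0\rangle}{\|u-u_0\|}\le0\}$ and $\mathcal J^-w(u_0)=\{p\in\mathcal Y^*:\liminf_{u\to u_0}\frac{w(u)-w(u_0)-\langle p,u-u_0\rangle}{\|u-u_0\|}\ge0\}$. For a fixed unit $d$, an upper semicontinuous $w$ is a viscosity subsolution of $-\langle\nabla w(u),d\rangle+\inf_{x\in S(u)}D_df_x(u)=0$ at $u_0$ if $-\langle\eta,d\rangle+\inf_{x\in S(u_0)}D_df_x(u_0)\le0$ for every $\eta\in\mathcal J^+w(u_0)$; a lower semicontinuous $w$ is a viscosity supersolution at $u_0$ if $-\langle\eta,d\rangle+\inf_{x\in S(u_0)}D_df_x(u_0)\ge0$ for every $\eta\in\mathcal J^-w(u_0)$; a viscosity solution is both; ''in a set'' means at every point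 of it. *)

(* Defs.v *)
From HB Require Import structures.
From mathcomp Require Import all_boot all_order all_algebra.
From mathcomp Require Import all_classical all_reals all_analysis.
Set Implicit Arguments. Unset Strict Implicit. Unset Printing Implicit Defensive.
Import Order.TTheory GRing.Theory Num.Theory.
Import numFieldNormedType.Exports.
Local Open Scope classical_set_scope.
Local Open Scope ring_scope.

Section Defs.
Context {R : realType}.

Definition is_dual {Y : normedModType R} (p : Y -> R) : Prop :=
  (forall (a : R) (x y : Y), p (a *: x + y) = a * p x + p y) /\ continuous p.

Definition dnorm {Y : normedModType R} (p : Y -> R) : R :=
  sup [set `|p y| | y in [set y : Y | `|y| <= 1]].

Definition reflexive_space (Y : normedModType R) : Prop :=
  forall Phi : (Y -> R) -> R,
    (forall (a : R) (p q : Y -> R), is_dual p -> is_dual q ->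
        Phi (fun y => a * p y + q y) = a * Phi p + Phi q) ->
    (exists C : R, forall p : Y -> R, is_dual p -> `|Phi p| <= C * dnorm p) ->
    exists y : Y, forall p : Y -> R, is_dual p -> Phi p = p y.

(* optimal value function v(u) = inf_{x in Phi(u)} f(x,u) (inf of empty = +oo) *)
Definition optval {XX Y : Type} (f : XX -> Y -> R) (Phi : Y -> set XX) (u : Y)
  : \bar R := ereal_inf [set (f x u)%:E | x in Phi u].

Definition optset {XX Y : Type} (f : XX -> Y -> R) (Phi : Y -> set XX) (u : Y)
  : set XX := [set x | Phi u x /\ (f x u)%:E = optval f Phi u].

Definition dquot {XX : Type} {Y : normedModType R} (f : XX -> Y -> R)
  (x : XX) (u d : Y) : R -> R := fun s => (f x (u + s *: d) - f x u) / s.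

Definition dirder_exists {XX : Type} {Y : normedModType R} (f : XX -> Y -> R)
  (x : XX) (u d : Y) : Prop := cvg (dquot f x u d @ 0^'+).

Definition dirder {XX : Type} {Y : normedModType R} (f : XX -> Y -> R)
  (x : XX) (u d : Y) : R := lim (dquot f x u d @ 0^'+).

(* inf_{x in S(u)} D_d f_x(u)  (in the extended reals, inf of empty = +oo) *)
Definition inf_dirder {XX : Type} {Y : normedModType R} (f : XX -> Y -> R)
  (Phi : Y -> set XX) (u d : Y) : \bar R :=
  ereal_inf [set (dirder f x u d)%:E | x in optset f Phi u].

Definition superdiff {Y : normedModType R} (w : Y -> R) (u0 : Y) (p : Y -> R)
  : Prop := is_dual p /\
  (limf_esup (fun u => ((w u - w u0 - p (u - u0)) / `|u - u0|)%:E) u0^' <= 0)%E.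

Definition visc_subsol_at {XX : Type} {Y : normedModType R} (f : XX -> Y -> R)
  (Phi : Y -> set XX) (d : Y) (w : Y -> R) (u0 : Y) : Prop :=
  forall eta : Y -> R, superdiff w u0 eta ->
    ((- eta d)%:E + inf_dirder f Phi u0 d <= 0)%E.

End Defs.

(* Main.v *)
Require Import Defs.
From HB Require Import structures.
From mathcomp Require Import all_boot all_order all_algebra.
From mathcomp Require Import all_classical all_reals all_analysis.
From mathcomp Require Import ring lra.
Import Order.TTheory GRing.Theory Num.Theory.
Import numFieldNormedType.Exports.
Local Open Scope classical_set_scope.
Local Open Scope ring_scope.

(** Conditions (i) and (ii), applied to [d] and [- d], bound every
superdifferential of [w] by [C0]. If [w y0 - w z > K Lam |y0 - z|] for a large
[K], then [w - K M(., z)] is larger at [y0] than at [z] and on the boundary of a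
ball around [z]. In infinite dimension a maximum on that ball is only attained
after a small smooth perturbation, namely a series of squares [M(x_n, .)^2]
centred at successive approximate maximizers (Borwein-Preiss). Its gradient is
small because of the upper bound in (H2) on the derivative of [M] in the second
variable, whereas the lower bound on the derivative in the first variable makes
the resulting superdifferential of [w] larger than [C0]. *)

(** * Fréchet derivatives of real functions *)

Section Frechet.
Context {R : realType} {Y : normedModType R}.
Implicit Types (f p : Y -> R) (y h : Y).

(** Only the little-o expansion is recorded. Linearity and boundedness of [p] are carried
    separately, so that [p] may be a series of functionals given as a plain function. *)
Definition has_frechet_derivative f y p :=
  forall e : R, 0 < e ->
    \forall h \near (0 : Y), `|f (y + h) - f y - p h| <= e * `|h|.

Lemma differentiable_has_frechet f y :
  differentiable f y -> has_frechet_derivative f y ('d f y : Y -> R).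
Proof.
move=> df e e0; have /eqaddoP/(_ e e0) := diff_locally df.
by apply: filterS => h /=; rewrite !fctE /= opprD addrA (addrC h y).
Qed.

Lemma has_frechet_continuous f y p (L : R) :
  (forall h, `|p h| <= L * `|h|) -> has_frechet_derivative f y p ->
  {for y, continuous f}.
Proof.
move=> pL fp; apply/cvgrPdist_le => e e0.
have L1 : 0 < `|L| + 1 by rewrite ltr_wpDl.
have : \forall h \near (0 : Y), `|f (y + h) - f y| <= e.
  have n0 : \forall h \near (0 : Y), `|h| < e / (`|L| + 1).
    by apply: nbhs0_lt; rewrite divr_gt0.
  have := fp 1 ltr01; apply: filterS2 n0 => h; rewrite ltr_pdivlMr// => he hf.
  have := pL h.
  have := ler_norm L; have := normr_ge0 h.
  have := ler_normD (f (y + h) - f y - p h) (p h); rewrite subrK.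
  move=> ? ? ? ?.
  have : L * `|h| <= `|L| * `|h| by rewrite ler_wpM2r.
  lra.
move=> H; rewrite [\forall x \near _, _ <= _](near_shift 0) subr0.
by apply: filterS H => t /=; rewrite (addrC t) distrC.
Qed.

Lemma has_frechet_sqr f y p (L : R) :
  (forall h, `|p h| <= L * `|h|) -> has_frechet_derivative f y p ->
  has_frechet_derivative (fun z => f z ^+ 2) y (fun h => 2 * f y * p h).
Proof.
move=> pL fp e e0.
pose A := 2 * `|f y| + 1.
have A0 : 0 < A by rewrite ltr_wpDl// mulr_ge0.
pose B := (`|L| + 1) ^+ 2.
have B0 : 0 < B by rewrite exprn_gt0// ltr_wpDl.
(* The bound by [e / 2 / A] handles the cross term [2 * f y * a]; the bound by 1 keeps the increment
   [b] below [(|L| + 1) |h|], so that its square is absorbed by shrinking [h]. *)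
pose e1 := Num.min 1 (e / 2 / A).
have e10 : 0 < e1 by rewrite lt_min ltr01 !divr_gt0.
have n0 : \forall h \near (0 : Y), `|h| < e / 2 / B.
  by apply: nbhs0_lt; rewrite !divr_gt0.
have := fp e1 e10; apply: filterS2 n0 => h.
rewrite ltr_pdivlMr// => hB hf.
set a := f (y + h) - f y - p h in hf.
set b := p h + a.
have -> : f (y + h) ^+ 2 - f y ^+ 2 - 2 * f y * p h = 2 * f y * a + b ^+ 2.
  by rewrite /b /a; ring.
have h0 := normr_ge0 h.
have e1e : e1 * A <= e / 2.
  by rewrite -ler_pdivlMr// ge_min lexx orbT.
have e11 : e1 <= 1 by rewrite ge_min lexx.
have bh : `|b| <= (`|L| + 1) * `|h|.
  have := ler_normD (p h) a; have := pL h.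
  have : L * `|h| <= `|L| * `|h| by rewrite ler_wpM2r// ler_norm.
  have : e1 * `|h| <= 1 * `|h| by rewrite ler_wpM2r.
  rewrite -/b; lra.
have b2 : `|b ^+ 2| <= B * `|h| * `|h|.
  rewrite normrX /B -mulrA -expr2 -exprMn ler_pXn2r// ?nnegrE ?mulr_ge0// ?addr_ge0//.
have b3 : B * `|h| * `|h| <= e / 2 * `|h|.
  by rewrite ler_wpM2r// mulrC ltW.
have a2 : `|2 * f y * a| <= A * e1 * `|h|.
  rewrite !normrM (@ger0_norm _ 2)// /A.
  apply: (@le_trans _ _ (2 * `|f y| * (e1 * `|h|))).
    by rewrite ler_wpM2l// mulr_ge0.
  by rewrite mulrA !ler_wpM2r ?(ltW e10)// lerDl.
have a3 : A * e1 * `|h| <= e / 2 * `|h| by rewrite ler_wpM2r// mulrC.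
have := ler_normD (2 * f y * a) (b ^+ 2); lra.
Qed.

(** Meant for the square of [m y _] at its own centre, where (H2) gives no derivative: [h = 0]
    forces [f y = 0], and a quadratic bound is little-o. *)
Lemma quadratic_has_frechet0 f y (C : R) :
  (forall h, `|f (y + h)| <= C * `|h| ^+ 2) ->
  has_frechet_derivative f y (fun=> 0).
Proof.
move=> fC e e0; have fy : f y = 0.
  by apply/normr0_eq0/le_anti; have := fC 0;
    rewrite addr0 normr0 expr0n mulr0 normr_ge0 => ->.
have C0 : 0 < `|C| + 1 by rewrite ltr_wpDl.
have n0 : \forall h \near (0 : Y), `|h| < e / (`|C| + 1).
  by apply: nbhs0_lt; rewrite !divr_gt0.
apply: filterS n0 => h; rewrite ltr_pdivlMr// => hC.
rewrite fy !subr0 (le_trans (fC h))// expr2 mulrA ler_wpM2r//.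
rewrite (le_trans _ (ltW hC))// mulrC ler_wpM2l//.
by rewrite (le_trans (ler_norm _))// lerDl.
Qed.

(** The mean value theorem on [[0, 1]] applies to [f (y + t *: h)] as a function of [t], whose
    derivative is [p t h] by homogeneity of [p t]. *)
Lemma has_frechet_segment_le f y h (p : R -> Y -> R) (L : R) :
  (forall t : R, 0 <= t <= 1 -> [/\ has_frechet_derivative f (y + t *: h) (p t),
      forall (a : R) u, p t (a *: u) = a * p t u &
      forall u, `|p t u| <= L * `|u|]) ->
  `|f (y + h) - f y| <= L * `|h|.
Proof.
move=> H; pose g (t : R) := f (y + t *: h).
have [c||c c01] := @MVT_segment R g (fun t => p t h) 0 1 ler01.
- rewrite in_itv/= => /andP[/ltW c0 /ltW c1].
  have [fp pZ pL] := H c (introT andP (conj c0 c1)).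
  suff cv : (fun k => k^-1 *: ((g \o shift c) (k *: (1 : R)) - g c)) @ 0^' --> p c h.
    by apply: DeriveDef; [apply/cvg_ex; exists (p c h)|exact: cvg_lim cv].
  apply/cvgrPdist_le => e e0.
  have h1 : 0 < `|h| + 1 by rewrite ltr_wpDl.
  have e1 : 0 < e / (`|h| + 1) by rewrite divr_gt0.
  have := fp _ e1 => /nbhs_ballP[d /= d0 dP].
  have : \forall k \near (0 : R)^', `|k| < d / (`|h| + 1).
    by apply: dnbhs0_lt; rewrite divr_gt0.
  have : \forall k \near (0 : R)^', k != 0 by exact: nbhs_dnbhs_neq.
  apply: filterS2 => k k0; rewrite ltr_pdivlMr// => kd.
  have kh : `|k *: h| < d.
    rewrite normrZ (le_lt_trans _ kd)// ler_wpM2l// lerDl//.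
  have := dP (k *: h); rewrite -ball_normE /= sub0r normrN => /(_ kh).
  rewrite pZ /g /= -(addrA y) -scalerDl.
  rewrite [k *: (1 : R)]mulr1 (addrC c k) normrZ => Hk.
  rewrite distrC.
  have -> : k^-1 *: (f (y + (k + c) *: h) - f (y + c *: h)) - p c h =
    k^-1 * (f (y + (k + c) *: h) - f (y + c *: h) - k * p c h).
    by rewrite [in RHS]mulrBr mulKf.
  rewrite normrM normfV mulrC ler_pdivrMr ?normr_gt0//.
  rewrite (le_trans Hk)// mulrCA mulrC ler_wpM2r//.
  by rewrite mulrAC ler_pdivrMr// ler_wpM2l ?(ltW e0)// lerDl.
- apply: continuous_in_subspaceT => t; rewrite inE /= in_itv /= => t01.
  have [fp _ pL] := H t t01.
  apply: continuous_comp; last exact: has_frechet_continuous pL fp.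
  by apply: continuousD; [exact: cst_continuous|exact: scalel_continuous].
- rewrite in_itv /= in c01; have [_ _ pL] := H c c01.
  rewrite /g scale1r scale0r addr0 subr0 mulr1 => ->; exact: pL.
Qed.
End Frechet.

(** * Series with dyadic weights *)

Section DyadicSum.
Context {R : realType}.
Implicit Types a b : nat -> R.

Lemma half_exp_lt (A e : R) : 0 < e -> exists N : nat, A / 2 ^+ N < e.
Proof.
move=> e0; pose N := Num.truncn (`|A| / e); exists N.
have p0 : 0 < (2 : R) ^+ N by rewrite exprn_gt0.
rewrite ltr_pdivrMr// mulrC -ltr_pdivrMr//.
have : `|A| / e < N.+1%:R by exact: truncnS_gt.
have : (N.+1%:R : R) <= 2 ^+ N by rewrite -natrX ler_nat ltn_expl.
have : A / e <= `|A| / e by rewrite ler_wpM2r ?ler_norm ?invr_ge0 ?(ltW e0).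
lra.
Qed.

Lemma dyadic_cauchy_cvg (V : completeNormedModType R) (u : nat -> V) (A : R) :
  (forall n, `|u n.+1 - u n| <= A / 2 ^+ n.+1) ->
  cvgn u /\ forall n, `|limn u - u n| <= A / 2 ^+ n.
Proof.
move=> uA.
(* The exact partial geometric sum, rather than [A / 2 ^+ n], makes the induction on [k] close. *)
have uk n k : `|u (n + k)%N - u n| <= A / 2 ^+ n - A / 2 ^+ (n + k).
  elim: k => [|k IH]; first by rewrite addn0 !subrr normr0.
  have := uA (n + k)%N; rewrite addnS.
  have := ler_normD (u (n + k).+1 - u (n + k)%N) (u (n + k)%N - u n).
  rewrite addrA subrK => H1 H2.
  have -> : A / 2 ^+ n - A / 2 ^+ (n + k).+1 =
    A / 2 ^+ n - A / 2 ^+ (n + k) + A / 2 ^+ (n + k).+1.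
    by rewrite exprS; field; rewrite !expf_neq0.
  lra.
have A0 : 0 <= A by have := le_trans (normr_ge0 _) (uA 0%N); rewrite pmulr_lge0.
have ub n m : (n <= m)%N -> `|u m - u n| <= A / 2 ^+ n.
  move=> /subnKC <-; apply: le_trans (uk _ _) _.
  by rewrite gerBl divr_ge0// exprn_ge0.
have cu : cvgn u.
  apply/cauchy_cvgP/cauchy_ballP => e e0.
  have [N HN] := half_exp_lt (2 * A) e e0.
  rewrite near_simpl; exists ([set m | (N <= m)%N], [set m | (N <= m)%N]).
    by split; exact: nbhs_infty_ge.
  move=> [m n] /= [Nm Nn]; rewrite -ball_normE /=.
  have := ub _ _ Nm; have := ub _ _ Nn.
  have := ler_normB (u m - u N) (u n - u N).
  rewrite opprB addrA subrK.
  move: HN; rewrite -mulrA; lra.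
split=> // n; rewrite distrC.
have cv : (fun m => `|u n - u m|) @ \oo --> `|u n - limn u|.
  by apply: cvg_norm; apply: cvgB => //; exact: cvg_cst.
rewrite -(cvg_lim _ cv)//; apply: limr_le; first exact: cvgP cv.
by exists n => // m /= nm; rewrite distrC ub.
Qed.

(** The shifted exponent makes the weights sum to 1, so a uniform bound on the terms passes
    unchanged to the sum. *)
Definition dyadic_psum a (n : nat) : R := \sum_(i < n) a i / 2 ^+ i.+1.

Definition dyadic_sum a : R := limn (dyadic_psum a).

Lemma dyadic_psum_le a (A : R) N : 0 <= A ->
  (forall i, (i < N)%N -> `|a i| <= A) -> `|dyadic_psum a N| <= A.
Proof.
move=> A0 aA; apply: (@le_trans _ _ (A - A / 2 ^+ N)); last first.
  by rewrite gerBl divr_ge0// exprn_ge0.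
elim: N aA => [|N IH] aA.
  by rewrite /dyadic_psum big_ord0 normr0 expr0 divr1 subrr.
rewrite /dyadic_psum big_ord_recr /=.
apply: le_trans (ler_normD _ _) _.
have -> : A - A / 2 ^+ N.+1 = A - A / 2 ^+ N + A / 2 ^+ N.+1.
  by rewrite exprS; field; rewrite !expf_neq0.
rewrite lerD ?IH// => [i iN|]; first by rewrite aA// ltnW.
by rewrite normrM normfV (@ger0_norm _ (2 ^+ _)) ?exprn_ge0// ler_wpM2r ?aA// invr_ge0 exprn_ge0.
Qed.

Lemma dyadic_sum_tail a (A : R) : (forall n, `|a n| <= A) ->
  cvgn (dyadic_psum a) /\
  forall n, `|dyadic_sum a - dyadic_psum a n| <= A / 2 ^+ n.
Proof.
move=> aA; apply: (@dyadic_cauchy_cvg R) => n.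
rewrite /dyadic_psum big_ord_recr /= [X in X - _]addrC addrK.
by rewrite normrM normfV (@ger0_norm _ (2 ^+ _)) ?exprn_ge0// ler_wpM2r ?aA// invr_ge0 exprn_ge0.
Qed.

Lemma dyadic_sum_le a (A : R) : (forall n, `|a n| <= A) -> `|dyadic_sum a| <= A.
Proof.
move=> /dyadic_sum_tail[_ /(_ 0%N)].
by rewrite /dyadic_psum big_ord0 subr0 divr1.
Qed.

Lemma dyadic_sumP (k : R) a b (A B : R) :
  (forall n, `|a n| <= A) -> (forall n, `|b n| <= B) ->
  dyadic_sum (fun n => k * a n + b n) = k * dyadic_sum a + dyadic_sum b.
Proof.
move=> /dyadic_sum_tail[ca _] /dyadic_sum_tail[cb _].
apply: cvg_lim => //.
have -> : dyadic_psum (fun n => k * a n + b n) =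
    (fun n => k * dyadic_psum a n + dyadic_psum b n).
  apply/funext => n; rewrite /dyadic_psum mulr_sumr -big_split /=.
  by apply: eq_bigr => i _; rewrite mulrDl mulrA.
by apply: cvgD => //; apply: cvgMl_tmp.
Qed.

Lemma dyadic_sumB a b (A B : R) :
  (forall n, `|a n| <= A) -> (forall n, `|b n| <= B) ->
  dyadic_sum (fun n => a n - b n) = dyadic_sum a - dyadic_sum b.
Proof.
move=> aA bB; rewrite addrC -mulN1r -(dyadic_sumP _ _ _ _ _ bB aA).
by congr dyadic_sum; apply/funext => n; rewrite mulN1r addrC.
Qed.

Lemma dyadic_psum_le_sum a (A : R) n : (forall n, `|a n| <= A) ->
  (forall n, 0 <= a n) -> dyadic_psum a n <= dyadic_sum a.
Proof.
move=> /dyadic_sum_tail[ca _] a0; apply: limr_ge => //.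
exists n => // m /= /subnKC <-; elim: (m - n)%N => [|k IH]; first by rewrite addn0.
rewrite addnS {2}/dyadic_psum big_ord_recr /= (le_trans IH)// lerDl.
by rewrite divr_ge0// exprn_ge0.
Qed.

(** Each remainder is at most [2 * L * |h|] uniformly in [n], so the tail beyond a large [N] costs
    little relative to [|h|]; the finite head is handled by the individual derivatives. *)
Lemma dyadic_sum_has_frechet (Y : normedModType R) (phi p : nat -> Y -> R) (y : Y)
    (r B L : R) :
  0 < r -> 0 <= L ->
  (forall n h, `|h| < r -> `|phi n (y + h)| <= B) ->
  (forall n h, `|h| < r -> `|phi n (y + h) - phi n y| <= L * `|h|) ->
  (forall n h, `|p n h| <= L * `|h|) ->
  (forall n, has_frechet_derivative (phi n) y (p n)) ->
  has_frechet_derivative (fun z => dyadic_sum (phi ^~ z)) y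
    (fun h => dyadic_sum (p ^~ h)).
Proof.
move=> r0 L0 phiB phiL pL phip e e0.
have e2 : 0 < e / 2 by rewrite divr_gt0.
have [N HN] := half_exp_lt (2 * L) _ e2.
have near1 : \forall h \near (0 : Y), forall i, (i < N)%N ->
    `|phi i (y + h) - phi i y - p i h| <= e / 2 * `|h|.
  elim: {HN} N => [|N IH]; first by apply: nearW.
  have := phip N _ e2; apply: filterS2 IH => h IH hN i.
  by rewrite ltnS leq_eqVlt => /predU1P[->//|/IH].
have := @nbhs0_lt _ Y _ r0; apply: filterS2 near1 => h hN hr.
have phi0B n : `|phi n y| <= B by have := phiB n 0; rewrite normr0 addr0; exact.
have DB n : `|phi n (y + h) - phi n y| <= L * `|h| by exact: phiL.
rewrite -(dyadic_sumB _ _ _ _ (fun n => phiB n h hr) phi0B).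
rewrite -(dyadic_sumB _ _ _ _ DB (pL ^~ h)).
set D := fun n => _ - p n h.
have Db n : `|D n| <= 2 * L * `|h|.
  have := ler_normB (phi n (y + h) - phi n y) (p n h).
  have := DB n; have := pL n h; rewrite /D; lra.
have [_ /(_ N) tail] := dyadic_sum_tail _ _ Db.
have head : `|dyadic_psum D N| <= e / 2 * `|h|.
  by apply: dyadic_psum_le => //; rewrite mulr_ge0// ltW.
have : 2 * L * `|h| / 2 ^+ N <= e / 2 * `|h|.
  by rewrite mulrAC ler_wpM2r// ltW.
have := ler_normD (dyadic_sum D - dyadic_psum D N) (dyadic_psum D N).
rewrite subrK; lra.
Qed.

End DyadicSum.

(** * A smooth variational principle of Borwein-Preiss type *)

Section VariationalPrinciple.
Context {R : realType} {Y : completeNormedModType R}.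

(** Positivity of the error and boundedness of the function sit inside the conclusion, so that a
    point exists for every pair and choice yields a total selector; [y0] is the default. *)
Lemma approx_maximizer (D : set Y) (y0 : Y) (eG : R * (Y -> R)) : D y0 ->
  exists x, D x /\ (0 < eG.1 -> (exists B, forall y, D y -> eG.2 y <= B) ->
    forall y, D y -> eG.2 y - eG.1 <= eG.2 x).
Proof.
case: eG => e G /= Dy0.
have [[e0 [B GB]]|nH] := pselect (0 < e /\ exists B, forall y, D y -> G y <= B).
  have hs : has_sup [set G y | y in D].
    by split; [exists (G y0), y0|exists B => _ [y Dy <-]; exact: GB].
  have [_ [x Dx <-] Gx] := sup_adherent e0 hs.
  exists x; split=> // _ _ y Dy; apply: ltW; apply: le_lt_trans Gx.
  by rewrite lerD2r; apply: ub_le_sup; [case: hs|exists y].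
by exists y0; split=> // e0 GB; case: nH.
Qed.

(** Near-maximizers [x n] are chosen in turn, each for the function already penalized around its
    predecessors. The penalty at [x n] vanishes there and grows at least like the squared distance,
    so the next point stays close; the limit maximizes the fully penalized function. *)
Lemma smooth_variational_principle (D : set Y) (y0 : Y) (q : Y -> Y -> R)
    (g : Y -> R) (lam A L B c : R) :
  closed D -> D y0 -> 0 < lam -> 0 < c ->
  (forall y, D y -> g y <= B) ->
  (forall y, D y -> {for y, continuous g}) ->
  (forall x, q x x = 0) ->
  (forall x y, D x -> D y -> lam * `|x - y| ^+ 2 <= q x y <= A) ->
  (forall x y z, D x -> D y -> D z -> `|q x y - q x z| <= L * `|y - z|) ->
  exists (x : nat -> Y) (yh : Y), (forall n, D (x n)) /\ D yh /\
    forall y, D y ->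
      g y - c * dyadic_sum (fun n => q (x n) y) <=
      g yh - c * dyadic_sum (fun n => q (x n) yh).
Proof.
move=> clD Dy0 lam0 c0 gB gC q0 qA qL.
have [pick pickP] := choice (fun eG => approx_maximizer D y0 eG Dy0).
(* Tuned so that a penalty [c / 2 ^+ n.+1 * q (x n) _] of at most [2 * eta n] confines the next
   point to distance [1 / 2 ^+ n.+1]. *)
pose eta n : R := c / 2 ^+ n.+1 * (lam / 2 * (2 ^+ n.+1)^-1 ^+ 2).
have pw n : 0 < (2 : R) ^+ n by rewrite exprn_gt0.
have eta0 n : 0 < eta n by rewrite !mulr_gt0 ?exprn_gt0 ?invr_gt0.
pose G := fix G n := if n is m.+1 then
   (fun y => G m y - c / 2 ^+ m.+1 * q (pick (eta m, G m)) y) else g.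
pose x n := pick (eta n, G n).
have Dx n : D (x n) by have [] := pickP (eta n, G n).
have qge0 z y : D z -> D y -> 0 <= q z y.
  by move=> Dz Dy; have /andP[+ _] := qA z y Dz Dy; apply: le_trans;
    rewrite mulr_ge0 ?exprn_ge0// ltW.
have GS n y : G n.+1 y = G n y - c / 2 ^+ n.+1 * q (x n) y by [].
have GSle n y : D y -> G n.+1 y <= G n y.
  by move=> Dy; rewrite GS gerBl mulr_ge0 ?qge0// divr_ge0 ?ltW.
have GB n y : D y -> G n y <= B.
  by move=> Dy; elim: n => [|n IH]; [exact: gB|exact: le_trans (GSle n y Dy) IH].
have xP n y : D y -> G n y - eta n <= G n (x n).
  move=> Dy; have [_ /(_ (eta0 n)) H] := pickP (eta n, G n).
  by apply: H => //; exists B => z; exact: GB.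
have Gsum n y : G n y = g y - c * dyadic_psum (fun k => q (x k) y) n.
  elim: n => [|n IH]; first by rewrite /dyadic_psum big_ord0 mulr0 subr0.
  rewrite GS IH /dyadic_psum big_ord_recr /=; ring.
have etaS n : eta n.+1 <= eta n.
  rewrite /eta ler_pM ?mulr_ge0 ?exprn_ge0 ?invr_ge0 ?ltW//.
    by rewrite ltr_pM2l// ltf_pV2 ?posrE// ltr_eXn2l// ltr1n.
  rewrite ltr_pM2l ?divr_gt0// ltr_pXn2r ?nnegrE ?invr_ge0 ?(ltW (pw _))//.
  by rewrite ltf_pV2 ?posrE// ltr_eXn2l// ltr1n.
(* [x n] and [x n.+1] are compared in both near-maximality statements; adding them bounds the
   penalty between them by [eta n + eta n.+1]. *)
have xstep n : `|x n.+1 - x n| <= 1 / 2 ^+ n.+1.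
  have h1 := xP n.+1 (x n) (Dx n); have h2 := xP n (x n.+1) (Dx n.+1).
  rewrite !GS q0 mulr0 subr0 in h1.
  have /andP[h3 _] := qA _ _ (Dx n) (Dx n.+1).
  have cn0 : 0 < c / 2 ^+ n.+1 by rewrite divr_gt0.
  have h4 : c / 2 ^+ n.+1 * q (x n) (x n.+1) <= 2 * eta n.
    have := etaS n; lra.
  have h5 : 2 * eta n = c / 2 ^+ n.+1 * (lam * (2 ^+ n.+1)^-1 ^+ 2).
    by rewrite /eta; field; rewrite expf_neq0.
  rewrite h5 ler_pM2l// in h4.
  rewrite div1r -(@ler_pXn2r _ 2) ?nnegrE ?invr_ge0 ?(ltW (pw _))// distrC.
  by rewrite -(@ler_pM2l _ lam)// (le_trans h3).
have [xc xlim] := dyadic_cauchy_cvg Y x 1 xstep.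
set yh := limn x in xlim.
have Dyh : D yh by apply: (closed_cvg D clD _ yh xc); apply: nearW.
exists x, yh; split=> //; split=> // y Dy.
have qb z : D z -> forall n, `|q (x n) z| <= A.
  by move=> Dz n; have /andP[_ ?] := qA _ _ (Dx n) Dz; rewrite ger0_norm ?qge0.
pose Psi z := dyadic_sum (fun n => q (x n) z).
have A0 : 0 <= A by apply: le_trans (qb y Dy 0%N).
(* The three terms pay for the error [eta n], for the tail of the series at [x n], and for moving
   the series from [x n] to [yh]. *)
pose K := c * lam + c * A + c * `|L|.
have key n : g y - c * Psi y <= g (x n) + (K * (2^-1) ^+ n - c * Psi yh).
  have h1 : g y - c * Psi y <= G n y.
    rewrite Gsum lerD2l lerN2 ler_pM2l//.
    by apply: (dyadic_psum_le_sum _ A) => [k|k]; [exact: qb|exact: qge0].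
  have h2 := xP n y Dy.
  have [_ /(_ n)] := dyadic_sum_tail _ _ (qb (x n) (Dx n)).
  rewrite ler_norml => /andP[_]; rewrite -/(Psi (x n)) => h3.
  have h4 : `|Psi yh - Psi (x n)| <= `|L| / 2 ^+ n.
    rewrite -(dyadic_sumB _ _ _ _ (qb _ Dyh) (qb _ (Dx n))).
    apply: dyadic_sum_le => k; apply: le_trans (qL _ _ _ (Dx k) Dyh (Dx n)) _.
    apply: (@le_trans _ _ (`|L| * `|yh - x n|)).
      by rewrite ler_wpM2r// ler_norm.
    by rewrite ler_wpM2l// (le_trans (xlim n))// div1r.
  have h5 : eta n <= c * lam / 2 ^+ n.
    have -> : eta n = c * lam / 2 ^+ n * ((2 ^+ n)^-1 ^+ 2 / 16).
      by rewrite /eta exprS; field; rewrite expf_neq0.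
    rewrite ler_piMr ?divr_ge0 ?mulr_ge0 ?ltW//.
    have : ((2 : R) ^+ n)^-1 ^+ 2 <= 1.
      by rewrite expr_le1 ?invr_ge0 ?(ltW (pw n))// invf_le1// exprn_ege1// ler1n.
    lra.
  rewrite Gsum in h1; rewrite !Gsum in h2.
  have := ler_norm (Psi yh - Psi (x n)).
  rewrite exprVn /K !mulrDl.
  set P := dyadic_psum _ _ in h3 h2; set P' := dyadic_psum _ _ in h2 h1.
  rewrite -(ler_pM2l c0) in h3.
  move=> /le_trans/(_ h4); rewrite -(ler_pM2l c0).
  rewrite !mulrBr !mulrA in h3 *.
  lra.
have Kc : (fun n => g (x n) + (K * (2^-1) ^+ n - c * Psi yh)) @ \oo -->
    g yh + (0 - c * Psi yh).
  apply: cvgD; first exact: continuous_cvg (gC yh Dyh) xc.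
  apply: cvgB; last exact: cvg_cst.
  by apply: cvg_geometric; rewrite ger0_norm ?invr_ge0// invf_lt1// ltr1n.
rewrite sub0r in Kc; rewrite -(cvg_lim _ Kc)//.
by apply: limr_ge; [exact: cvgP Kc|apply: nearW].
Qed.

End VariationalPrinciple.

(** * Dual norm, superdifferentials and their bound under the viscosity inequality *)

Section Dual.
Context {R : realType} {Y : normedModType R}.
Implicit Types (p w : Y -> R) (u h : Y).

Definition linear_form p := forall (a : R) x y, p (a *: x + y) = a * p x + p y.

Lemma linear_form0 p : linear_form p -> p 0 = 0.
Proof. by move=> pl; have := pl 1 0 0; rewrite scaler0 addr0 mul1r; lra. Qed.

Lemma linear_formZ p (a : R) x : linear_form p -> p (a *: x) = a * p x.
Proof. by move=> pl; rewrite -[a *: x]addr0 pl linear_form0// addr0. Qed.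

Lemma linear_formB p x y : linear_form p -> p (x - y) = p x - p y.
Proof. by move=> pl; rewrite addrC -scaleN1r pl mulN1r addrC. Qed.

Lemma bounded_is_dual p (L : R) :
  linear_form p -> (forall h, `|p h| <= L * `|h|) -> is_dual p.
Proof.
move=> pl pL; split=> // x; apply/cvgrPdist_le => e e0.
have L1 : 0 < `|L| + 1 by rewrite ltr_wpDl.
have : \forall t \near x, `|x - t| < e / (`|L| + 1).
  by apply: cvgr_dist_lt; [exact: cvg_id|rewrite divr_gt0].
apply: filterS => t; rewrite ltr_pdivlMr// => xt.
rewrite -(linear_formB p)// (le_trans (pL _))// (le_trans _ (ltW xt))// mulrC.
by rewrite ler_wpM2l// (le_trans (ler_norm L))// lerDl.
Qed.

Lemma dnorm_gt p (l : R) : l < dnorm p -> exists h, `|h| <= 1 /\ l < `|p h|.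
Proof.
move=> /sup_gt[|_ [h h1 <-] lh]; last by exists h.
by exists `|p 0|, 0 => //=; rewrite normr0.
Qed.

Lemma le_dnorm p h : is_dual p -> `|p h| <= dnorm p * `|h|.
Proof.
move=> [pl pc].
(* The supremum in [dnorm] dominates its set only once that set is known to be bounded, which
   follows from continuity at 0. *)
have ub : has_ubound [set `|p y| | y in [set y : Y | `|y| <= 1]].
  have := pc 0; rewrite /continuous_at linear_form0// => /cvgrPdist_le/(_ 1 ltr01).
  move=> /nbhs_ballP[d /= d0 dP]; exists (2 / d) => _ [y y1 <-].
  have := dP (d / 2 *: y); rewrite -ball_normE /= !sub0r !normrN.
  rewrite (linear_formZ p)// normrM normrZ !(@gtr0_norm _ (d / 2)) ?divr_gt0// => H.
  have /H : d / 2 * `|y| < d.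
    have : d / 2 * `|y| <= d / 2 * 1 by rewrite ler_wpM2l// ltW// divr_gt0.
    lra.
  by rewrite -ler_pdivlMl ?divr_gt0// invf_div mulr1.
have [->|h0] := eqVneq h 0; first by rewrite linear_form0// !normr0 mulr0.
have nh : 0 < `|h| by rewrite normr_gt0.
rewrite -ler_pdivrMr//; apply: ub_le_sup => //; exists (`|h|^-1 *: h) => /=.
  by rewrite normrZ normfV normr_id mulVf// gt_eqF.
by rewrite (linear_formZ p)// normrM normfV normr_id mulrC.
Qed.

(** The upper limit is an infimum over punctured neighbourhoods, so for each [e] the neighbourhood
    where the quotient is at most [e] suffices. *)
Lemma superdiff_intro w u p : is_dual p ->
  (forall e : R, 0 < e ->
    \forall h \near (0 : Y), w (u + h) - w u - p h <= e * `|h|) ->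
  superdiff w u p.
Proof.
move=> pd H; split=> //; apply/lee_addgt0Pr => e e0; rewrite add0e.
apply: ge_ereal_inf.
pose V := [set t : Y | w t - w u - p (t - u) <= e * `|t - u| /\ t != u].
exists (ereal_sup [set ((w t - w u - p (t - u)) / `|t - u|)%:E | t in V]).
  exists V => //.
  have Vu : \forall t \near u, w t - w u - p (t - u) <= e * `|t - u|.
    rewrite [\forall x \near _, _ <= _](near_shift 0) subr0.
    by apply: filterS (H e e0) => h /=; rewrite addrK (addrC h).
  rewrite /dnbhs /within /=; apply: filterS Vu => t Vt tu; exact: conj.
apply: ge_ereal_sup => _ [t [Vt tu] <-].
by rewrite lee_fin ler_pdivrMr// normr_gt0 subr_eq0.
Qed.

End Dual.

(** The subsolution inequality puts [eta d] above the infimum of directional derivatives, hence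
    above [- C0]; using [d] and [- d] makes this two-sided. *)
Lemma visc_subsol_superdiff_le {R : realType} {XX : Type} {Y : normedModType R}
    (f : XX -> Y -> R) (Phi : Y -> set XX) (w : Y -> R) (u : Y) (C0 : R) (eta : Y -> R) :
  (forall d, `|d| = 1 -> ((- C0)%:E < inf_dirder f Phi u d)%E) ->
  (forall d, `|d| = 1 -> visc_subsol_at f Phi d w u) ->
  superdiff w u eta -> forall h, `|eta h| <= C0 * `|h|.
Proof.
move=> fC wu eta_sd h; have [[etal _] _] := eta_sd.
have bd d : `|d| = 1 -> - C0 <= eta d.
  move=> d1; have := wu d d1 eta eta_sd; have := fC d d1.
  (* The value [+oo], as for an empty optimal set, contradicts the subsolution inequality, and [-oo]
     contradicts the lower bound. *)
  case: (inf_dirder f Phi u d) => [i| |] //=.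
  by rewrite lte_fin -EFinD lee_fin; lra.
have [->|h0] := eqVneq h 0; first by rewrite linear_form0// !normr0 mulr0.
have nh : 0 < `|h| by rewrite normr_gt0.
have n1 : `| `|h|^-1 *: h| = 1.
  by rewrite normrZ normfV normr_id mulVf// gt_eqF.
have := bd _ n1; have := bd (- (`|h|^-1 *: h)); rewrite normrN => /(_ n1).
have etaN x : eta (- x) = - eta x by rewrite -scaleN1r (linear_formZ eta)// mulN1r.
rewrite etaN (linear_formZ eta)// lerN2 => h1 h2.
have -> : eta h = `|h| * (`|h|^-1 * eta h) by rewrite mulVKf// gt_eqF.
by rewrite normrM normr_id mulrC ler_pM2r// ler_norml h2 h1.
Qed.

(** * The Lipschitz estimate on a ball *)

Section LipschitzEstimate.
Context {R : realType} {Y : completeNormedModType R}.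
Context (m : Y -> Y -> R) (lam Lam : R) (lam0 : 0 < lam) (Lam0 : 0 < Lam)
  (m_bounds : forall x y, lam * `|x - y| <= m x y <= Lam * `|x - y|)
  (m_diffl : forall x y, x != y -> differentiable (fun z => m z y) x)
  (m_diffr : forall x y, x != y -> differentiable (fun z => m x z) y)
  (m_dnorml : forall x y, x != y ->
    lam <= dnorm ('d (fun z => m z y) x : Y -> R))
  (m_dnormr : forall x y, x != y ->
    dnorm ('d (fun z => m x z) y : Y -> R) <= Lam).

Lemma diff_linear_form (f : Y -> R) (x : Y) : linear_form ('d f x : Y -> R).
Proof. by move=> a u v; rewrite linearP. Qed.

Lemma diff_is_dual (f : Y -> R) (x : Y) :
  differentiable f x -> is_dual ('d f x : Y -> R).
Proof.
by move=> df; split; [exact: diff_linear_form|exact: diff_continuous].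
Qed.

Lemma m_ge0 x y : 0 <= m x y.
Proof.
by have /andP[+ _] := m_bounds x y; apply: le_trans; rewrite mulr_ge0// ltW.
Qed.

Lemma m_diag x : m x x = 0.
Proof.
by have := m_bounds x x; rewrite subrr normr0 !mulr0 => /le_anti.
Qed.

Lemma m_continuousl y x : {for x, continuous (fun z => m z y)}.
Proof.
have [->|xy] := eqVneq x y; last exact/differentiable_continuous/m_diffl.
apply/cvgrPdist_le => e e0.
have : \forall t \near y, `|y - t| < e / Lam.
  by apply: cvgr_dist_lt; [exact: cvg_id|rewrite divr_gt0].
apply: filterS => t; rewrite ltr_pdivlMr// m_diag sub0r normrN ger0_norm ?m_ge0//.
have /andP[_ +] := m_bounds t y; rewrite distrC mulrC; lra.
Qed.

(** The derivative of [m x _ ^+ 2] at [y]; at the centre it is 0, because the upper bound on [m]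
    makes the square quadratically small there. *)
Definition dsqr (x y h : Y) : R :=
  if x == y then 0 else 2 * m x y * ('d (fun z => m x z) y : Y -> R) h.

Lemma dsqr_linear x y : linear_form (dsqr x y).
Proof.
move=> a u v; rewrite /dsqr; case: eqP => _; first by rewrite mulr0 addr0.
by rewrite diff_linear_form; ring.
Qed.

Lemma diff_mr_le x y h : x != y ->
  `|('d (fun z => m x z) y : Y -> R) h| <= Lam * `|h|.
Proof.
move=> xy; apply: le_trans (le_dnorm _ _ (diff_is_dual _ _ (m_diffr _ _ xy))) _.
by rewrite ler_wpM2r// m_dnormr.
Qed.

Lemma dsqr_le x y h : `|dsqr x y h| <= 2 * Lam ^+ 2 * `|x - y| * `|h|.
Proof.
rewrite /dsqr; have [_|xy] := eqVneq.
  by rewrite normr0 !mulr_ge0 ?exprn_ge0 ?(ltW Lam0)//.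
rewrite !normrM (@ger0_norm _ 2)// (ger0_norm (m_ge0 _ _)).
have /andP[_ h1] := m_bounds x y; have h2 := diff_mr_le x y h xy.
have -> : 2 * Lam ^+ 2 * `|x - y| * `|h| = 2 * (Lam * `|x - y|) * (Lam * `|h|).
  by ring.
by rewrite ler_pM ?mulr_ge0 ?m_ge0// ler_wpM2l.
Qed.

Lemma sqr_has_frechet x y :
  has_frechet_derivative (fun z => m x z ^+ 2) y (dsqr x y).
Proof.
have [->|xy] := eqVneq x y.
  have -> : dsqr y y = fun=> 0 by apply/funext => h; rewrite /dsqr eqxx.
  apply: (quadratic_has_frechet0 _ _ (Lam ^+ 2)) => h.
  have /andP[_] := m_bounds y (y + h); rewrite opprD addNKr normrN => mh.
  rewrite normrX ger0_norm ?m_ge0// -exprMn.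
  by rewrite ler_pXn2r ?nnegrE ?m_ge0// mulr_ge0// ltW.
have -> : dsqr x y = fun h => 2 * m x y * ('d (fun z => m x z) y : Y -> R) h.
  by apply/funext => h; rewrite /dsqr (negbTE xy).
apply: (has_frechet_sqr _ _ _ Lam); first by move=> h; exact: diff_mr_le.
exact: differentiable_has_frechet (m_diffr _ _ xy).
Qed.

(** The condition on [B] keeps the perturbed maximizer off the boundary of the ball; the condition
    on [C0] makes the slope of [K * m _ z] exceed [C0] by a margin of 1 that absorbs the
    perturbation. *)
Lemma superdiff_bound_lipschitz (w : Y -> R) (z y0 : Y) (r B C0 K : R) :
  0 < r -> 0 <= C0 -> 0 < K ->
  B <= K * lam * r -> C0 + 1 <= K * (lam / 2) ->
  (forall y, `|z - y| <= 2 * r -> {for y, continuous w}) ->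
  (forall y, `|z - y| <= 2 * r -> `|w y| <= B) ->
  (forall y eta, `|z - y| <= 2 * r -> superdiff w y eta ->
     forall h, `|eta h| <= C0 * `|h|) ->
  `|z - y0| <= 2 * r ->
  w y0 - w z <= K * (Lam * `|y0 - z|).
Proof.
move=> r0 C00 K0 KB KC wC wB wS Dy0; rewrite leNgt; apply/negP => contra.
pose D := closed_ball_ Num.Def.normr z (2 * r).
have Dz : D z by rewrite /D /closed_ball_ /= subrr normr0 mulr_ge0// ltW.
have Ddist x y : D x -> D y -> `|x - y| <= 4 * r.
  rewrite /D /closed_ball_ /= => zx zy; have := ler_normB (z - y) (z - x).
  rewrite opprB addrC subrKA.
  lra.
have Dconv x h (t : R) : D x -> D (x + h) -> 0 <= t <= 1 -> D (x + t *: h).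
  rewrite /D /closed_ball_ /= => zx zxh /andP[t0 t1].
  have -> : z - (x + t *: h) = (1 - t) *: (z - x) + t *: (z - (x + h)).
    by rewrite !opprD !addrA scalerBl scale1r (scalerBr t (z - x)) addrA subrK.
  apply: le_trans (ler_normD _ _) _; rewrite !normrZ (ger0_norm t0).
  rewrite (@ger0_norm _ (1 - t)) ?subr_ge0//.
  have : (1 - t) * `|z - x| <= (1 - t) * (2 * r) by rewrite ler_wpM2l// subr_ge0.
  have : t * `|z - (x + h)| <= t * (2 * r) by rewrite ler_wpM2l.
  lra.
pose q x y := m x y ^+ 2.
pose g y := w y - w z - K * m y z.
pose A := (Lam * (4 * r)) ^+ 2.
pose L := 2 * Lam ^+ 2 * (4 * r).
have A0 : 0 <= A by rewrite exprn_ge0// ?mulr_ge0 ?(ltW Lam0) ?(ltW r0)//.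
have L0 : 0 <= L by rewrite ?mulr_ge0 ?exprn_ge0 ?(ltW Lam0) ?(ltW r0)//.
have gy0 : 0 < g y0.
  have /andP[_ h1] := m_bounds y0 z.
  have : K * m y0 z <= K * (Lam * `|y0 - z|) by rewrite ler_pM2l.
  rewrite /g; lra.
(* The first bound keeps the gradient of the perturbation below 1, the second keeps its size below
   half of [g y0], so that [g] stays positive at the perturbed maximizer. *)
pose c := Num.min (1 / (L + 1)) (g y0 / 2 / (A + 1)).
have L1 : 0 < L + 1 by lra.
have A1 : 0 < A + 1 by lra.
have c0 : 0 < c by rewrite lt_min !divr_gt0.
have cL : c * L <= 1.
  have : c * (L + 1) <= 1 by rewrite -ler_pdivlMr// ge_min lexx.
  lra.
have cA : c * A <= g y0 / 2.
  have : c * (A + 1) <= g y0 / 2 by rewrite -ler_pdivlMr// ge_min lexx orbT.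
  lra.
have qb x y : D x -> D y -> `|q x y| <= A.
  move=> Dx Dy; have /andP[_ h1] := m_bounds x y.
  rewrite normrX ger0_norm ?m_ge0// ler_pXn2r ?nnegrE ?m_ge0 ?mulr_ge0 ?(ltW Lam0) ?(ltW r0)//.
  by rewrite (le_trans h1)// ler_wpM2l ?(ltW Lam0)// Ddist.
have qL x y h : D x -> D y -> D (y + h) -> `|q x (y + h) - q x y| <= L * `|h|.
  move=> Dx Dy Dyh.
  (* The squared gauge is differentiable everywhere, even when the segment meets its centre;
     convexity of the ball bounds the derivative along the segment. *)
  apply: (has_frechet_segment_le _ _ _ (fun t => dsqr x (y + t *: h))) => t t01.
  split; first exact: sqr_has_frechet.
    by move=> a u; rewrite (linear_formZ (dsqr x _))//; exact: dsqr_linear.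
  move=> u; apply: le_trans (dsqr_le _ _ _) _.
  rewrite ler_wpM2r// ler_wpM2l ?mulr_ge0 ?exprn_ge0 ?(ltW Lam0)//.
  by rewrite Ddist//; exact: Dconv.
have [] := smooth_variational_principle D y0 q g (lam ^+ 2) A L (2 * B) c.
- exact: closed_closed_ball_.
- exact: Dy0.
- by rewrite exprn_gt0.
- by [].
- move=> y Dy; have := wB _ Dy; have := wB _ Dz; rewrite !ler_norml.
  have : 0 <= K * m y z by rewrite mulr_ge0 ?m_ge0// ltW.
  by rewrite /g => ? /andP[? ?] /andP[? ?]; lra.
- move=> y Dy; apply: continuousB.
    by apply: continuousB; [exact: wC|exact: cst_continuous].
  by apply: continuousM; [exact: cst_continuous|exact: m_continuousl].
- by move=> x; rewrite /q m_diag expr0n.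
- move=> x y Dx Dy; apply/andP; split.
    have /andP[h1 _] := m_bounds x y.
    rewrite -exprMn ler_pXn2r ?nnegrE ?m_ge0//.
    by rewrite mulr_ge0// ltW.
  exact: le_trans (ler_norm _) (qb _ _ Dx Dy).
- move=> x y y' Dx Dy Dy'; have := qL x y' (y - y') Dx Dy'.
  by rewrite addrC subrK; exact.
move=> x [yh [Dx [Dyh yhmax]]].
pose Psi y := dyadic_sum (fun n => q (x n) y).
have Psi_le y : D y -> `|Psi y| <= A by move=> Dy; apply: dyadic_sum_le => n; exact: qb.
have Psiyh : 0 <= Psi yh.
  have := dyadic_psum_le_sum (fun n => q (x n) yh) A 0.
  rewrite {1}/dyadic_psum big_ord0; apply=> n; first exact: qb.
  by rewrite exprn_ge0// m_ge0.
have gyh : 0 < g yh.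
  have := yhmax _ Dy0; rewrite -/(Psi y0) -/(Psi yh).
  have : c * Psi y0 <= c * A.
    by rewrite ler_pM2l// (le_trans (ler_norm _))// Psi_le.
  have : 0 <= c * Psi yh by rewrite mulr_ge0// ltW.
  lra.
(* Since [g z = 0], positivity of [g yh] separates the two points, so [m _ z] is differentiable at
   [yh]. *)
have yhz : yh != z.
  by apply/eqP => yhz; move: gyh; rewrite yhz /g m_diag mulr0 !subrr ltxx.
(* On the boundary [K * m yh z] is at least [2 * B], hence at least [w yh - w z], which would make
   [g yh] nonpositive. *)
have yh_int : `|z - yh| < 2 * r.
  rewrite lt_neqAle Dyh andbT; apply/eqP => yhb.
  have /andP[h1 _] := m_bounds yh z; rewrite distrC yhb in h1.
  have : K * (lam * (2 * r)) <= K * m yh z by rewrite ler_pM2l.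
  have := wB _ Dyh; have := wB _ Dz; rewrite !ler_norml.
  move: gyh; rewrite /g => ? /andP[? ?] /andP[? ?]; lra.
pose d1 : Y -> R := 'd (fun y => m y z) yh.
pose d2 h := dyadic_sum (fun n => dsqr (x n) yh h).
pose p h := K * d1 h + c * d2 h.
have dx n h : `|dsqr (x n) yh h| <= L * `|h|.
  apply: le_trans (dsqr_le _ _ _) _.
  by rewrite ler_wpM2r// ler_wpM2l ?mulr_ge0 ?exprn_ge0 ?(ltW Lam0)// Ddist.
have d2L h : `|d2 h| <= L * `|h| by apply: dyadic_sum_le => n; exact: dx.
have d1_dual : is_dual d1 by apply: diff_is_dual; exact: m_diffl.
have d1L h : `|d1 h| <= dnorm d1 * `|h| by exact: le_dnorm.
have p_dual : is_dual p.
  apply: (bounded_is_dual _ (K * dnorm d1 + c * L)) => [a u v|h].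
    rewrite /p /d1 diff_linear_form /d2.
    have -> : (fun n => dsqr (x n) yh (a *: u + v)) =
        (fun n => a * dsqr (x n) yh u + dsqr (x n) yh v).
      by apply/funext => n; exact: dsqr_linear.
    rewrite (dyadic_sumP _ _ _ (L * `|u|) (L * `|v|))//; ring.
  apply: le_trans (ler_normD _ _) _; rewrite !normrM (gtr0_norm K0) (gtr0_norm c0) mulrDl.
  by rewrite -(mulrA K) -(mulrA c) lerD ?ler_pM2l.
have e0 : 0 < 2 * r - `|z - yh| by rewrite subr_gt0.
have De h : `|h| < 2 * r - `|z - yh| -> D (yh + h).
  rewrite /D /closed_ball_ /=.
  have := ler_normB (z - yh) h; rewrite opprD addrA; lra.
have Psi_frechet : has_frechet_derivative Psi yh d2.
  apply: (dyadic_sum_has_frechet _ _ _ _ _ A L e0 L0) => [n h /De Dh|n h /De Dh|//|n].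
  - exact: qb.
  - exact: qL.
  - exact: sqr_has_frechet.
(* Maximality of [yh] bounds the increment of [w] by that of [K * m _ z + c * Psi], whose derivative
   is [p]. *)
have p_super : superdiff w yh p.
  apply: superdiff_intro => // e e_gt0.
  have e1 : 0 < e / 2 / K by rewrite !divr_gt0.
  have e2 : 0 < e / 2 / c by rewrite !divr_gt0.
  have f1 := differentiable_has_frechet _ _ (m_diffl _ _ yhz) _ e1.
  have := Psi_frechet _ e2; apply: filterS3 f1 (@nbhs0_lt _ Y _ e0) => h f1 /De Dh f2.
  rewrite mulrAC ler_pdivlMr// mulrC in f1.
  rewrite mulrAC ler_pdivlMr// mulrC in f2.
  have := yhmax _ Dh; rewrite -/(Psi _) -/(Psi yh) /g /p.
  have : K * (m (yh + h) z - m yh z - d1 h) <= e / 2 * `|h|.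
    by rewrite (le_trans _ f1)// ler_pM2l// ler_norm.
  have : c * (Psi (yh + h) - Psi yh - d2 h) <= e / 2 * `|h|.
    by rewrite (le_trans _ f2)// ler_pM2l// ler_norm.
  lra.
(* The dual norm need not be attained; a value strictly below [lam] is exceeded at some vector of
   the unit ball. *)
have [|h [h1 hl]] := dnorm_gt d1 (lam / 2).
  rewrite (lt_le_trans _ (m_dnorml _ _ yhz))//.
  by rewrite ltr_pdivrMr// ltr_pMr// ltr1n.
have := wS yh p Dyh p_super h; apply/negP; rewrite -ltNge.
have hC : C0 * `|h| <= C0 by rewrite ler_piMr.
have hL : c * `|d2 h| <= 1.
  apply: le_trans cL; rewrite ler_pM2l// (le_trans (d2L h))//.
  by rewrite ler_piMr.
have := ler_normB (p h) (c * d2 h); rewrite {1}/p addrK.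
rewrite !normrM (gtr0_norm K0) (gtr0_norm c0).
have : K * (lam / 2) < K * `|d1 h| by rewrite ltr_pM2l.
lra.
Qed.

End LipschitzEstimate.

(** * Local Lipschitz continuity of viscosity subsolutions *)

Theorem mainTheorem1 (R : realType)
  (XX Y : completeNormedModType R)
  (X : set XX) (U : set Y) (f : XX -> Y -> R) (Phi : Y -> set XX)
  (w : Y -> R)
  (* standing assumptions *)
  (hXne : X !=set0) (hUne : U !=set0)
  (hf : {within X `*` U, continuous (fun p : XX * Y => f p.1 p.2)})
  (hPhi : forall u, U u -> Phi u `<=` X)
  (* U open, w continuous and locally bounded on U *)
  (hUopen : open U)
  (hwcont : forall u, U u -> {for u, continuous w})
  (hwbd : forall u, U u -> exists r : R, 0 < r /\ exists B : R,
            forall y, ball u r y -> U y -> `|w y| <= B)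
  (* (H1) *)
  (H1 : reflexive_space Y)
  (* (H2) *)
  (H2 : exists M : Y -> Y -> \bar R,
     (forall y1 y2, (0 <= M y1 y2)%E) /\
     (forall y1 y2, y1 != y2 -> differentiable (fun y => fine (M y y2)) y1) /\
     (forall y1 y2, y1 != y2 -> differentiable (fun y => fine (M y1 y)) y2) /\
     exists lam Lam : R, 0 < lam /\ lam <= 1 /\ 1 <= Lam /\
       (forall y1 y2, ((lam * `|y1 - y2|)%:E <= M y1 y2)%E /\
                      (M y1 y2 <= (Lam * `|y1 - y2|)%:E)%E) /\
       (forall y1 y2, y1 != y2 ->
          lam <= dnorm ('d (fun y => fine (M y y2)) y1 : Y -> R)) /\
       (forall y1 y2, y1 != y2 ->
          dnorm ('d (fun y => fine (M y1 y)) y2 : Y -> R) <= Lam))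
  (* (i) *)
  (hi1 : forall x u d, X x -> U u -> `|d| = 1 -> dirder_exists f x u d)
  (hi2 : exists C0 : R, 0 < C0 /\
     forall u d, U u -> `|d| = 1 -> ((- C0)%:E < inf_dirder f Phi u d)%E)
  (* (ii) *)
  (hii : forall d, `|d| = 1 -> forall u0, U u0 -> visc_subsol_at f Phi d w u0) :
  (* w is locally Lipschitz in U *)
  forall u, U u -> exists r : R, 0 < r /\ exists L : R,
    forall y z, ball u r y -> ball u r z -> U y -> U z ->
      `|w y - w z| <= L * `|y - z|.
Proof.
have [M [M0 [dMl [dMr [lam [Lam [lam0 [_ [Lam1 [MM [nMl nMr]]]]]]]]]]] := H2.
have [C0 [C00 hC0]] := hi2.
pose m a b := fine (M a b).
have Lam0 : 0 < Lam by rewrite (lt_le_trans ltr01).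
(* The two-sided bound forces [M] to be finite, so [fine] loses nothing. *)
have mb a b : lam * `|a - b| <= m a b <= Lam * `|a - b|.
  have [] := MM a b; rewrite /m; case: (M a b) => //= s.
  by rewrite !lee_fin => -> ->.
move=> u Uu; have [rb [rb0 [B wB]]] := hwbd u Uu.
have /nbhs_ballP[ro /= ro0 roU] : nbhs u U by exact: open_nbhs_nbhs.
(* A closed ball of radius [2 * r] around a point of [ball u r] stays within distance [3 * r] of
   [u], hence inside [U] and the region where [w] is bounded by [B]. *)
pose r := Num.min rb ro / 4.
have r0 : 0 < r by rewrite divr_gt0// lt_min rb0.
have r4 : 4 * r = Num.min rb ro by rewrite /r; field.
clearbody r.
have rrb : 4 * r <= rb by rewrite r4 ge_min lexx.
have rro : 4 * r <= ro by rewrite r4 ge_min lexx orbT.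
have near z y : ball u r z -> `|z - y| <= 2 * r -> U y /\ `|w y| <= B.
  rewrite -ball_normE /= => uz zy.
  have uy : `|u - y| < 4 * r by have := ler_distD z u y; lra.
  have Uy : U y by apply: roU; rewrite -ball_normE /=; lra.
  by split=> //; apply: wB => //; rewrite -ball_normE /=; lra.
have B0 : 0 <= B by apply: le_trans (normr_ge0 (w u)) (wB u _ Uu); exact: ballxx.
(* The two summands meet the slope condition and the boundary condition of the ball estimate,
   respectively. *)
pose K := 2 * (C0 + 1) / lam + B / (lam * r).
have K1 : 0 < 2 * (C0 + 1) / lam by rewrite divr_gt0// mulr_gt0// addr_gt0.
have K2 : 0 <= B / (lam * r) by rewrite divr_ge0// mulr_ge0// ltW.
have K0 : 0 < K by rewrite ltr_pwDl.
have est y z : ball u r y -> ball u r z -> w y - w z <= K * (Lam * `|y - z|).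
  move=> uy uz.
  apply: (superdiff_bound_lipschitz m lam Lam lam0 Lam0 mb dMl dMr nMl nMr
    w z y r B C0 K r0 (ltW C00) K0).
  - by rewrite -mulrA -ler_pdivrMr ?mulr_gt0// /K lerDr ltW.
  - have -> : C0 + 1 = 2 * (C0 + 1) / lam * (lam / 2) by field; rewrite gt_eqF.
    by rewrite ler_pM2r ?divr_gt0// /K lerDl.
  - by move=> t zt; apply: hwcont; have [] := near z t uz zt.
  - by move=> t zt; have [] := near z t uz zt.
  - move=> t eta zt; have [Ut _] := near z t uz zt.
    by apply: visc_subsol_superdiff_le => d d1; [exact: hC0|exact: hii].
  - move: uy uz; rewrite -!ball_normE /= => uy uz.
    have := ler_distD u z y; rewrite (distrC z u); lra.
exists r; split=> //; exists (K * Lam) => y z uy uz _ _.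
rewrite -mulrA ler_norml est// andbT lerNl opprB distrC est//.
Qed.
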